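(* The group $P_{\mathrm{br}}$ is not Hopfian; that is, there exists a surjective homomorphism $P_{\mathrm{br}}\to P_{\mathrm{br}}$ that is not injective.
   Context: A tree means a finite rooted binary tree (every non-leaf vertex has a left and a right child; the one-vertex tree is allowed); its leaves are numbered $1,\dots,n$ from left to right. $T\cup\lambda_k$ denotes the tree obtained from $T$ by attaching a caret (a vertex with two children) to its $k$-th leaf. $PB_n$ is the pure braid group on $n$ strands. The cloning map $\kappa_k^n\colon PB_n\to PB_{n+1}$ is the injective homomorphism that replaces the $k$-th strand by two parallel strands. $P_{\mathrm{br}}$ is the set of equivalence classes of triples $(T,p,T)$, with $T$ a tree with some number $n$ of leaves and $p\in PB_n$, under the equivalence relation generated by the expansions $(T,p,T)\sim(T\cup\lambda_k,\kappa_k^n(p),T\cup\lambda_k)$, $1\le k\le n$. It is a group under the multiplication determined by $(T,p,T)(T,q,T)=(T,pq,T)$ (any two elements can be expanded to have a common tree). Equivalently, $P_{\mathrm{br}}$ is the direct limit, over the directed set of trees ordered by attaching carets to leaves, of copies $PB_T\cong PB_{n(T)}$ of the pure braid groups (where $n(T)$ is the number of leaves of $T$), with morphisms induced by the cloning maps. *)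

(* Defs.v *)
From HB Require Import structures.
From mathcomp Require Import all_boot.
From mathcomp Require Import boolp.
From mathcomp Require Import zify.
From Stdlib Require Import Relation_Operators.

Set Implicit Arguments.
Unset Strict Implicit.
Unset Printing Implicit Defensive.

Local Open Scope group_scope.
Local Open Scope quotient_scope.

(* Strands and their positions are numbered from 0.  The letter [(i, false)]
   is the Artin generator crossing the strands in positions [i] and [i.+1];
   [(i, true)] is its inverse.  Words are read from top to bottom. *)
Definition letter n := ('I_n.-1 * bool)%type.
Definition word n := seq (letter n).

Inductive artin n : word n -> word n -> Prop :=
| ArtinCancel i b : artin [:: (i, b); (i, ~~ b)] [::]
| ArtinComm (i j : 'I_n.-1) : i.+1 < j ->
    artin [:: (i, false); (j, false)] [:: (j, false); (i, false)]
| ArtinBraid (i j : 'I_n.-1) : j = i.+1 :> nat ->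
    artin [:: (i, false); (j, false); (i, false)]
          [:: (j, false); (i, false); (j, false)].

Inductive braid_step n : word n -> word n -> Prop :=
| BraidStep p s u v : artin u v -> braid_step (p ++ u ++ s) (p ++ v ++ s).

Definition braid_rel n : rel (word n) :=
  fun u v => `[< clos_refl_sym_trans _ (@braid_step n) u v >].

Lemma braid_rel_refl n : reflexive (@braid_rel n).
Proof. by move=> u; apply/asboolP; apply: rst_refl. Qed.

Lemma braid_rel_sym n : symmetric (@braid_rel n).
Proof. by move=> u v; apply/idP/idP => /asboolP h; apply/asboolP; apply: rst_sym. Qed.

Lemma braid_rel_trans n : transitive (@braid_rel n).
Proof.
move=> v u w /asboolP huv /asboolP hvw; apply/asboolP; exact: rst_trans huv hvw.
Qed.

Canonical braid_equiv n :=
  EquivRel (@braid_rel n) (@braid_rel_refl n) (@braid_rel_sym n)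
    (@braid_rel_trans n).

Definition braid n := {eq_quot braid_equiv n}.
HB.instance Definition _ n := Choice.on (braid n).
HB.instance Definition _ n := EqQuotient.on (braid n).

Lemma pi_braidP n (u v : word n) :
  clos_refl_sym_trans _ (@braid_step n) u v <->
  \pi_(braid n) u = \pi_(braid n) v.
Proof. by split=> [h|/eqmodP/asboolP//]; apply/eqmodP/asboolP. Qed.

Lemma braid_lift n A (f : word n -> A) :
    (forall p s u v, artin u v -> f (p ++ u ++ s) = f (p ++ v ++ s)) ->
  forall u v, \pi_(braid n) u = \pi_(braid n) v -> f u = f v.
Proof.
move=> fP u v /pi_braidP; elim=> {u v} [_ _ [p s u v /fP]|||] //.
by move=> u v w _ -> _ ->.
Qed.

Lemma pi_braid_step n (p s u v : word n) : artin u v ->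
  \pi_(braid n) (p ++ u ++ s) = \pi_(braid n) (p ++ v ++ s).
Proof. by move=> uv; apply/pi_braidP; apply: rst_step. Qed.

Definition inv_word n (w : word n) : word n :=
  rev [seq (l.1, ~~ l.2) | l <- w].

Definition braid_one n : braid n := \pi_(braid n) [::].
Definition braid_mul n (x y : braid n) : braid n := \pi_(braid n) (repr x ++ repr y).
Definition braid_inv n (x : braid n) : braid n := \pi_(braid n) (inv_word (repr x)).

Lemma pi_braid_cat n (u v : word n) :
  \pi_(braid n) (u ++ v) = braid_mul (\pi u) (\pi v).
Proof.
rewrite /braid_mul.
transitivity (\pi_(braid n) (repr (\pi_(braid n) u) ++ v)).
  apply: (@braid_lift n _ (fun u => \pi_(braid n) (u ++ v))); last by rewrite reprK.
  by move=> p s a b ab; rewrite -!catA; apply: pi_braid_step.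
move: (repr _) => {}u.
apply: (@braid_lift n _ (fun v => \pi_(braid n) (u ++ v))); last by rewrite reprK.
by move=> p s a b ab; rewrite !(catA u); apply: pi_braid_step.
Qed.

Lemma braid_mulA n : associative (@braid_mul n).
Proof.
move=> x y z; rewrite -[x]reprK -[y]reprK -[z]reprK.
by rewrite -!pi_braid_cat catA.
Qed.

Lemma braid_mul1 n : left_id (braid_one n) (@braid_mul n).
Proof. by move=> x; rewrite -[x]reprK -pi_braid_cat. Qed.

Lemma braid_1mul n : right_id (braid_one n) (@braid_mul n).
Proof. by move=> x; rewrite -[x]reprK -pi_braid_cat cats0. Qed.

Lemma pi_braid_invl n (w : word n) : \pi_(braid n) (inv_word w ++ w) = \pi [::].
Proof.
elim: w => [//|[i b] w IHw] /=.
rewrite /inv_word /= rev_cons cat_rcons -cat1s.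
have -> (a : word n) : a ++ (i, ~~ b) :: [:: (i, b)] ++ w =
   a ++ [:: (i, ~~ b); (i, b)] ++ w by [].
rewrite (pi_braid_step _ _ (v := [::])) //.
by have := ArtinCancel i (~~ b); rewrite negbK.
Qed.

Lemma pi_braid_invr n (w : word n) : \pi_(braid n) (w ++ inv_word w) = \pi [::].
Proof.
have := pi_braid_invl (inv_word w); rewrite {1}/inv_word map_rev revK -map_comp.
by rewrite (eq_map (g := id)) ?map_id // => -[i b] /=; rewrite negbK.
Qed.

Lemma braid_mulV n : left_inverse (braid_one n) (@braid_inv n) (@braid_mul n).
Proof.
by move=> x; rewrite -[X in braid_mul _ X]reprK -pi_braid_cat pi_braid_invl.
Qed.

Lemma braid_Vmul n : right_inverse (braid_one n) (@braid_inv n) (@braid_mul n).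
Proof.
by move=> x; rewrite -[X in braid_mul X _]reprK -pi_braid_cat pi_braid_invr.
Qed.

HB.instance Definition _ n := isGroup.Build (braid n) (@braid_mulA n)
  (@braid_mul1 n) (@braid_1mul n) (@braid_mulV n) (@braid_Vmul n).

Lemma pi_cat n (u v : word n) : \pi_(braid n) (u ++ v) = \pi_(braid n) u * \pi_(braid n) v.
Proof. exact: pi_braid_cat. Qed.

Lemma pi_nil n : \pi_(braid n) [::] = 1.
Proof. by []. Qed.

Definition swap (i k : nat) : nat :=
  if k == i then i.+1 else if k == i.+1 then i else k.

(* The bottom position of the strand of [w] that starts in position [k]. *)
Fixpoint track n (w : word n) (k : nat) : nat :=
  if w is l :: w' then track w' (swap l.1 k) else k.

Definition strand n (b : braid n) (k : nat) : nat := track (repr b) k.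

Lemma track_cat n (u v : word n) k : track (u ++ v) k = track v (track u k).
Proof. by elim: u k => /=. Qed.

Lemma swapK i : involutive (swap i).
Proof. by move=> k; rewrite /swap; do !case: eqP => //=; lia. Qed.

Lemma track_artin n (u v : word n) k : artin u v -> track u k = track v k.
Proof.
case=> [i b|i j ij|i j ij] /=; first exact: swapK.
  by rewrite /swap; do !case: eqP => //=; lia.
by rewrite ij /swap; do !case: eqP => //=; lia.
Qed.

Lemma strand_pi n (w : word n) k : strand (\pi_(braid n) w) k = track w k.
Proof.
apply: (@braid_lift n _ (fun w => track w k)); last by rewrite reprK.
by move=> p s u v uv; rewrite !track_cat (track_artin _ uv).
Qed.

Lemma strandM n (x y : braid n) k : strand (x * y) k = strand y (strand x k).
Proof.
by rewrite -[x]reprK -[y]reprK -pi_cat !strand_pi track_cat.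
Qed.

Lemma strand1 n k : strand (1 : braid n) k = k.
Proof. by rewrite -pi_nil strand_pi. Qed.

Definition pure n : pred (braid n) := fun b => [forall k : 'I_n, strand b k == k].
Arguments pure : clear implicits.

Lemma pureP n (b : braid n) :
  reflect (forall k, k < n -> strand b k = k) (pure n b).
Proof.
apply: (iffP forallP) => [bP k kn|bP k]; last by rewrite bP.
by rewrite (eqP (bP (Ordinal kn))).
Qed.

Lemma track_out n (w : word n) k : n <= k -> track w k = k.
Proof.
move=> nk; elim: w => //= [[i b] w IHw] /=; have := ltn_ord i => ltin.
by rewrite /swap !ifN ?IHw //; apply/eqP; lia.
Qed.

Lemma strand_pure n (b : braid n) k : pure n b -> strand b k = k.
Proof. by move=> /pureP bP; case: (ltnP k n) => [/bP//|]; apply: track_out. Qed.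

Lemma pure_group_closed n : group_closed (pure n).
Proof.
split=> [|x y xP yP]; first by apply/pureP=> k _; rewrite strand1.
apply/pureP=> k _; rewrite strandM (strand_pure _ xP).
by rewrite -[k in LHS](strand_pure _ yP) -strandM mulgV strand1.
Qed.

(* The kernel of the map from [braid n] to the permutations of the strands. *)
Definition PB n := {b : braid n | pure n b}.
HB.instance Definition _ n := Choice.on (PB n).
HB.instance Definition _ n := SubType.on (PB n).
HB.instance Definition _ n :=
  SubChoice_isSubGroup.Build (braid n) (pure n) (PB n) (@pure_group_closed n).

Lemma gen_lo_subproof n (i : 'I_n.-1) : i < n.
Proof. by have := ltn_ord i; lia. Qed.

Lemma gen_hi_subproof n (i : 'I_n.-1) : i.+1 < n.
Proof. by have := ltn_ord i; lia. Qed.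

Definition gen_lo n (i : 'I_n.-1) : 'I_n.+1.-1 := Ordinal (gen_lo_subproof i).
Definition gen_hi n (i : 'I_n.-1) : 'I_n.+1.-1 := Ordinal (gen_hi_subproof i).

(* The crossing [l] after doubling the strand that starts in position [k]; the
   two middle cases are those where the doubled strand is one of the two
   strands that cross, and then each copy crosses the other strand, with the
   sign of [l]. *)
Definition clone_letter n (k : nat) (l : letter n) : word n.+1 :=
  let: (i, b) := l in
  if k < i then [:: (gen_hi i, b)]
  else if k == i then [:: (gen_hi i, b); (gen_lo i, b)]
  else if k == i.+1 then [:: (gen_lo i, b); (gen_hi i, b)]
  else [:: (gen_lo i, b)].

Fixpoint clone_word n (k : nat) (w : word n) : word n.+1 :=
  if w is l :: w' then clone_letter k l ++ clone_word (swap l.1 k) w' else [::].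

Definition clone n (k : nat) (b : braid n) : braid n.+1 :=
  \pi_(braid n.+1) (clone_word k (repr b)).

(* Generators with indices in [nat]; the value at [i >= n.-1] is irrelevant. *)
Definition sg n (i : nat) : braid n :=
  if @insub _ _ 'I_n.-1 i is Some j then \pi_(braid n) [:: (j, false)] else 1.

Lemma sgE n (i : 'I_n.-1) : sg n i = \pi_(braid n) [:: (i, false)].
Proof. by rewrite /sg valK. Qed.

Lemma pi_letterV n (i : 'I_n.-1) b :
  \pi_(braid n) [:: (i, ~~ b)] = (\pi_(braid n) [:: (i, b)])^-1.
Proof.
symmetry; apply: mulg1_eq.
rewrite -pi_cat -[X in \pi_(braid n) X]cats0 -[X in \pi_(braid n) X]cat0s.
by rewrite (pi_braid_step _ _ (ArtinCancel i b)).
Qed.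

Lemma pi_letter n (i : 'I_n.-1) b :
  \pi_(braid n) [:: (i, b)] = if b then (sg n i)^-1 else sg n i.
Proof. by case: b; rewrite sgE // -(pi_letterV i false). Qed.

Lemma sg_comm n i j : i.+1 < j -> sg n i * sg n j = sg n j * sg n i.
Proof.
move=> ij; case: (ltnP j n.-1) => jn; last by rewrite {2 3}/sg insubN ?mulg1 ?mul1g // -leqNgt.
have i_n : i < n.-1 by lia.
rewrite (sgE (Ordinal i_n)) (sgE (Ordinal jn)) -!pi_cat /=.
have := @ArtinComm n (Ordinal i_n) (Ordinal jn) ij.
by move/(pi_braid_step [::] [::]).
Qed.

Lemma sg_braid n i : i.+2 < n ->
  sg n i * sg n i.+1 * sg n i = sg n i.+1 * sg n i * sg n i.+1.
Proof.
move=> lt_i; have i_n : i < n.-1 by lia.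
have jn : i.+1 < n.-1 by lia.
rewrite (sgE (Ordinal i_n)) (sgE (Ordinal jn)) -!pi_cat /=.
have := @ArtinBraid n (Ordinal i_n) (Ordinal jn) erefl.
by move/(pi_braid_step [::] [::]).
Qed.

Lemma swap_cases i k : [\/ k = i /\ swap i k = i.+1, k = i.+1 /\ swap i k = i
  | (k < i \/ i.+1 < k) /\ swap i k = k].
Proof.
rewrite /swap; case: eqP => [->|]; first by constructor 1.
case: eqP => [->|]; first by constructor 2.
by constructor 3; split=> //; lia.
Qed.

Definition clone_gen n k i : braid n.+1 :=
  if k < i then sg n.+1 i.+1
  else if k == i then sg n.+1 i.+1 * sg n.+1 i
  else if k == i.+1 then sg n.+1 i * sg n.+1 i.+1
  else sg n.+1 i.

Lemma gen_cases i k : [\/ k < i, k = i, k = i.+1 | i.+1 < k].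
Proof.
have [h|h|->] := ltngtP k i; [constructor 1| |constructor 2] => //.
by have [] := ltngtP k i.+1; [lia|constructor 4|constructor 3].
Qed.

Lemma clone_gen_lt n k i : k < i -> clone_gen n k i = sg n.+1 i.+1.
Proof. by move=> ki; rewrite /clone_gen ki. Qed.

Lemma clone_gen0 n i : clone_gen n i i = sg n.+1 i.+1 * sg n.+1 i.
Proof. by rewrite /clone_gen ltnn eqxx. Qed.

Lemma clone_genS n i : clone_gen n i.+1 i = sg n.+1 i * sg n.+1 i.+1.
Proof. by rewrite /clone_gen eqxx !ifN //; lia. Qed.

Lemma clone_gen_gt n k i : i.+1 < k -> clone_gen n k i = sg n.+1 i.
Proof. by move=> ik; rewrite /clone_gen !ifN //; lia. Qed.

Lemma swap_id i k : (k < i) || (i.+1 < k) -> swap i k = k.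
Proof. by move=> ik; rewrite /swap !ifN //; lia. Qed.

Lemma swap0 i : swap i i = i.+1.
Proof. by rewrite /swap eqxx. Qed.

Lemma swapS i : swap i i.+1 = i.
Proof. by rewrite /swap eqxx ifN //; lia. Qed.

Lemma clone_letterE n k (i : 'I_n.-1) b :
  \pi_(braid n.+1) (clone_letter k (i, b)) =
  if b then (clone_gen n (swap i k) i)^-1 else clone_gen n k i.
Proof.
have pi2 (a c : letter n.+1) : \pi_(braid n.+1) [:: a; c] =
   \pi_(braid n.+1) [:: a] * \pi_(braid n.+1) [:: c].
  by rewrite -pi_cat.
rewrite /clone_letter /clone_gen; case: (swap_cases i k) => -[h ->]; first last.
- have -> : (k == i) = false by lia.
  have -> : (k == i.+1) = false by lia.
  by case: ifP => _; rewrite pi_letter.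
- have -> : (k < i) = false by lia.
  have -> : (k == i) = false by lia.
  rewrite h !eqxx ltnn pi2 !pi_letter; case: b => //.
  by rewrite invgM.
have -> : (k < i) = false by lia.
have -> : (i.+1 < i) = false by lia.
have -> : (i.+1 == i) = false by lia.
by rewrite h !eqxx pi2 !pi_letter; case: b; rewrite ?invgM.
Qed.

Lemma clone_word_cat n k (u v : word n) :
  clone_word k (u ++ v) = clone_word k u ++ clone_word (track u k) v.
Proof. by elim: u k => //= l u IHu k; rewrite IHu catA. Qed.

Lemma clone_gen_comm n k i j : i.+1 < j ->
  clone_gen n k i * clone_gen n (swap i k) j =
  clone_gen n k j * clone_gen n (swap j k) i.
Proof.
move=> ij.
have sgc a b : a.+1 < b -> commute (sg n.+1 a) (sg n.+1 b) by apply: sg_comm.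
have sgc' a b : a.+1 < b -> commute (sg n.+1 b) (sg n.+1 a).
  by move=> ab; apply/commute_sym/sgc.
have cM (x y z : braid n.+1) : commute x z -> commute y z -> commute (x * y) z.
  by move=> xz yz; apply/commute_sym/commuteM; apply/commute_sym.
case: (gen_cases i k) => hi; case: (gen_cases j k) => hj; try lia; subst;
  repeat first [rewrite clone_gen0 | rewrite clone_genS
    | rewrite clone_gen_lt; last lia | rewrite clone_gen_gt; last lia
    | rewrite swap0 | rewrite swapS | rewrite swap_id; last lia];
  rewrite -/(commute _ _); repeat first [apply: cM | apply: commuteM];
  by [apply: sgc; lia | apply: sgc'; lia].
Qed.

Lemma clone_gen_braid n k i : i.+2 < n ->
  clone_gen n k i * clone_gen n (swap i k) i.+1 *
    clone_gen n (swap i.+1 (swap i k)) i =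
  clone_gen n k i.+1 * clone_gen n (swap i.+1 k) i *
    clone_gen n (swap i (swap i.+1 k)) i.+1.
Proof.
move=> lt_i.
have ab := @sg_braid n.+1 i (ltnW lt_i).
have bc := @sg_braid n.+1 i.+1 lt_i.
have ac := @sg_comm n.+1 i i.+2 (leqnn _).
have [lt_ki|] := ltnP k i; first by rewrite !swap_id ?lt_ki ?orbT ?clone_gen_lt //; lia.
have [lt_ik _|le_k le_ik] := ltnP i.+2 k.
  by rewrite !swap_id ?clone_gen_gt //; lia.
have : [\/ k = i, k = i.+1 | k = i.+2].
  have : (k == i) || (k == i.+1) || (k == i.+2) by lia.
  by case/orP=> [/orP[]|] /eqP->; [constructor 1|constructor 2|constructor 3].
case=> ->.
- rewrite !swap0 (@swap_id i.+1 i) ?leqnn // !swap0 !clone_gen0 clone_gen_gt // clone_gen_lt //.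
  move: (sg n.+1 i) (sg n.+1 i.+1) (sg n.+1 i.+2) ab bc ac => a b c ab bc ac.
  rewrite !mulgA -(mulgA b a c) ac !mulgA -(mulgA _ a b) -(mulgA _ (a * b)) ab.
  rewrite !mulgA bc -(mulgA _ c a) -ac.
  by rewrite !mulgA.
- rewrite swapS swap0 (@swap_id i.+1 i) ?leqnn // (@swap_id i i.+2) ?leqnn ?orbT //.
  rewrite !clone_genS clone_gen0 clone_gen_lt // clone_gen0 clone_gen_gt //.
  move: (sg n.+1 i) (sg n.+1 i.+1) (sg n.+1 i.+2) ab bc ac => a b c ab bc ac.
  rewrite !mulgA -(mulgA a b c) -(mulgA a (b * c) b) bc !mulgA.
  by rewrite -(mulgA _ c a) -ac !mulgA ac -(mulgA c a b) -(mulgA c (a * b) a) ab !mulgA.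
- rewrite (@swap_id i i.+2) ?leqnn ?orbT // swapS swapS !clone_genS (@clone_gen_gt _ i.+2) // clone_gen_lt //.
  move: (sg n.+1 i) (sg n.+1 i.+1) (sg n.+1 i.+2) ab bc ac => a b c ab bc ac.
  rewrite !mulgA -(mulgA _ c a) -ac !mulgA ab -(mulgA _ b c) -(mulgA _ (b * c) b).
  by rewrite bc !mulgA -(mulgA b a c) ac !mulgA.
Qed.

Lemma clone_word_artin n k (u v : word n) : artin u v ->
  \pi_(braid n.+1) (clone_word k u) = \pi_(braid n.+1) (clone_word k v).
Proof.
case=> [i b|i j ij|i j ij]; rewrite /= ?cats0 ?pi_cat !clone_letterE.
- by case: b; rewrite ?swapK ?mulVg ?mulgV.
- exact: clone_gen_comm.
- rewrite !mulgA ij; apply: clone_gen_braid.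
  by have := ltn_ord j; lia.
Qed.

Lemma clone_pi n k (w : word n) :
  clone k (\pi_(braid n) w) = \pi_(braid n.+1) (clone_word k w).
Proof.
pose f w := \pi_(braid n.+1) (clone_word k w).
apply: (@braid_lift n _ f); last by rewrite reprK.
move=> p s u v uv; rewrite /f !clone_word_cat !pi_cat.
by rewrite (clone_word_artin _ uv) (track_artin _ uv).
Qed.

Lemma cloneM n k (x y : braid n) :
  clone k (x * y) = clone k x * clone (strand x k) y.
Proof.
by rewrite -[x]reprK -[y]reprK -pi_cat !clone_pi clone_word_cat pi_cat strand_pi.
Qed.

(* The position, after doubling the strand in position [k], of the strand that
   was in position [j] (the left copy if [j = k]). *)
Definition shift_pos (k j : nat) : nat := if k < j then j.+1 else j.

Lemma track_clone_letter n k j (i : 'I_n.-1) b :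
  track (clone_letter k (i, b)) (shift_pos k j) =
  shift_pos (swap i k) (swap i j).
Proof.
rewrite /shift_pos /clone_letter; case: (swap_cases i k) => -[h ->];
case: (swap_cases i j) => -[h' ->]; (repeat case: ifP); rewrite /= /swap;
  try lia; (repeat case: ifP); try lia.
Qed.

Lemma track_clone_letterS n k (i : 'I_n.-1) b :
  track (clone_letter k (i, b)) k.+1 = (swap i k).+1.
Proof.
rewrite /clone_letter; case: (swap_cases i k) => -[h ->];
 (repeat case: ifP); rewrite /= /swap; try lia; (repeat case: ifP); try lia.
Qed.

Lemma strand_clone n k j (b : braid n) :
  strand (clone k b) (shift_pos k j) = shift_pos (strand b k) (strand b j).
Proof.
rewrite -[b]reprK clone_pi !strand_pi.
elim: (repr b) k j => //= -[i c] w IHw k j.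
by rewrite track_cat track_clone_letter IHw.
Qed.

Lemma strand_cloneS n k (b : braid n) :
  strand (clone k b) k.+1 = (strand b k).+1.
Proof.
rewrite -[b]reprK clone_pi !strand_pi.
elim: (repr b) k => //= -[i c] w IHw k.
by rewrite track_cat track_clone_letterS IHw.
Qed.

Lemma clone_pure n k (b : braid n) : pure n b -> pure n.+1 (clone k b).
Proof.
move=> bP; apply/pureP=> j _.
have [jk|kj|->] := ltngtP j k.+1.
- have := strand_clone k j b.
  by rewrite /shift_pos !(strand_pure _ bP) ltnNge -ltnS jk.
- case: j kj => // j kj; have := strand_clone k j b.
  by rewrite /shift_pos !(strand_pure _ bP) ifT.
- by rewrite strand_cloneS strand_pure.
Qed.

(* For [n <= k], where no strand is doubled, this adds a strand at the end;
   only [k < n] is used in [expand_step] below. *)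
Definition kappa n (k : nat) (p : PB n) : PB n.+1 :=
  Sub (clone k (val p)) (clone_pure k (valP p)).

Lemma val_kappa n k (p : PB n) : val (kappa k p) = clone k (val p).
Proof. exact: SubK. Qed.

Lemma kappaM n k : {morph @kappa n k : p q / p * q}.
Proof.
move=> p q; apply: val_inj; rewrite val_kappa !valM !val_kappa cloneM.
by rewrite (strand_pure _ (valP p)).
Qed.

Lemma kappa1 n k : @kappa n k 1 = 1.
Proof. by apply: (mulIg (kappa k 1)); rewrite -kappaM !mul1g. Qed.

HB.instance Definition _ n k := isMultiplicative.Build _ _ _ (@kappaM n k).

Lemma clone1 n k : clone k (1 : braid n) = 1.
Proof. by rewrite -pi_nil clone_pi. Qed.

Lemma cloneV n k (x : braid n) : clone k x^-1 = (clone (strand x^-1 k) x)^-1.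
Proof.
apply: (mulIg (clone (strand x^-1 k) x)).
by rewrite -cloneM !mulVg clone1.
Qed.

Lemma strand_sg n (i k : nat) : i < n.-1 -> strand (sg n i) k = swap i k.
Proof. by move=> lt_i; rewrite (sgE (Ordinal lt_i)) strand_pi. Qed.

Lemma clone_sg n i k : i < n.-1 -> clone k (sg n i) = clone_gen n k i.
Proof.
move=> lt_i; rewrite (sgE (Ordinal lt_i)) clone_pi /= cats0.
exact: (clone_letterE k (Ordinal lt_i) false).
Qed.

Lemma clone_clone_gen n k l i : k < l -> i < n.-1 ->
  clone k (clone l (sg n i)) = clone l.+1 (clone k (sg n i)).
Proof.
move=> kl lt_i; rewrite !clone_sg //.
have i1 : i < n.+1.-1 by lia.
have i2 : i.+1 < n.+1.-1 by lia.
have c2 := @sg_comm n.+2 i i.+2 (leqnn _).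
case: (gen_cases i k) => hk; case: (gen_cases i l) => hl; try lia; subst;
  do 2!(repeat first [rewrite clone_gen0 | rewrite clone_genS
      | rewrite clone_gen_lt; last lia | rewrite clone_gen_gt; last lia
      | rewrite swap0 | rewrite swapS | rewrite swap_id; last lia];
    rewrite ?cloneM ?strand_sg // ?clone_sg //);
  by rewrite ?mulgA // -[X in X * _]mulgA c2 !mulgA.
Qed.

Lemma braid_ind n (P : braid n -> Prop) : P 1 ->
    (forall i x, i < n.-1 -> P x -> P (sg n i * x)) ->
    (forall i x, i < n.-1 -> P x -> P ((sg n i)^-1 * x)) ->
  forall x, P x.
Proof.
move=> P1 Psg PsgV x; rewrite -[x]reprK.
elim: (repr x) => [|[i b] w IHw]; first by rewrite pi_nil.
rewrite -cat1s pi_cat pi_letter; case: b.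
  by apply: PsgV; rewrite ?ltn_ord.
by apply: Psg; rewrite ?ltn_ord.
Qed.

Lemma clone_clone n k l (x : braid n) : k != l ->
  clone (shift_pos l k) (clone l x) = clone (shift_pos k l) (clone k x).
Proof.
have gen i a b : i < n.-1 -> a != b ->
    clone (shift_pos b a) (clone b (sg n i)) =
    clone (shift_pos a b) (clone a (sg n i)).
  move=> lt_i ab; rewrite /shift_pos.
  by case: ltngtP ab => // ab _; [symmetry|]; apply: clone_clone_gen.
have swap_neq i a b : a != b -> swap i a != swap i b.
  by move=> ab; rewrite (inj_eq (can_inj (swapK i))).
elim/braid_ind: x k l => [k l _|i x lt_i IHx k l kl|i x lt_i IHx k l kl].
- by rewrite !clone1.
- rewrite !cloneM !strand_clone !strand_sg // gen // IHx //; exact: swap_neq.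
have strandV j : strand (sg n i)^-1 j = swap i j.
  apply: (can_inj (swapK i)); rewrite -(@strand_sg n) //.
  by rewrite -strandM mulVg strand1 swapK.
rewrite !cloneM !strand_clone !strandV IHx ?swap_neq //; congr (_ * _).
rewrite !cloneV !strandV.
have sV a b : strand (clone a (sg n i))^-1 (shift_pos (swap i a) (swap i b))
   = shift_pos a b.
  rewrite -(strand_sg a lt_i) -(strand_sg b lt_i) -strand_clone -strandM.
  by rewrite mulgV strand1.
have sV' a b : strand (clone (swap i a) (sg n i))^-1 (shift_pos a b)
   = shift_pos (swap i a) (swap i b).
  by rewrite -{2}[a](swapK i) -{1}[b](swapK i) sV.
by rewrite !sV' gen // swap_neq.
Qed.

Lemma kappa_kappa n k l (p : PB n) : k < l ->
  kappa k (kappa l p) = kappa l.+1 (kappa k p).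
Proof.
move=> kl; apply: val_inj; rewrite !val_kappa.
have := @clone_clone n k l (val p); rewrite /shift_pos kl.
by rewrite ifN; [apply; lia | lia].
Qed.

Inductive tree : Type := Leaf | Node (l r : tree).

Fixpoint tree_encode (T : tree) : GenTree.tree unit :=
  if T is Node l r then GenTree.Node 0 [:: tree_encode l; tree_encode r]
  else GenTree.Leaf tt.

Fixpoint tree_decode (t : GenTree.tree unit) : tree :=
  if t is GenTree.Node _ [:: l; r] then Node (tree_decode l) (tree_decode r)
  else Leaf.

Lemma tree_encodeK : cancel tree_encode tree_decode.
Proof. by elim=> //= l -> r ->. Qed.

HB.instance Definition _ := Choice.copy tree (can_type tree_encodeK).

Fixpoint nleaves (T : tree) : nat :=
  if T is Node l r then nleaves l + nleaves r else 1%N.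

(* Leaves are numbered from 0, from left to right; the value for
   [nleaves T <= k] is irrelevant. *)
Fixpoint attach_tree (T : tree) (k : nat) : tree :=
  if T is Node l r then
    if k < nleaves l then Node (attach_tree l k) r
    else Node l (attach_tree r (k - nleaves l))
  else Node Leaf Leaf.

Lemma nleaves_attach T k : nleaves (attach_tree T k) = (nleaves T).+1.
Proof.
elim: T k => //= l IHl r IHr k; case: ifP => _ /=; first by rewrite IHl.
by rewrite IHr addnS.
Qed.

Definition ntree n := {T : tree | nleaves T == n}.

Lemma attach_subproof n (T : ntree n) k :
  nleaves (attach_tree (val T) k) == n.+1.
Proof. by rewrite nleaves_attach (eqP (valP T)). Qed.

Definition attach n (T : ntree n) (k : nat) : ntree n.+1 :=
  exist _ (attach_tree (val T) k) (attach_subproof T k).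

(* [triple T p] stands for $(T, p, T)$. *)
Definition triples := {n : nat & (ntree n * PB n)%type}.
HB.instance Definition _ := Choice.on triples.

Definition triple n (T : ntree n) (p : PB n) : triples :=
  Tagged (fun n => ntree n * PB n)%type (T, p).

Inductive expand_step : triples -> triples -> Prop :=
| ExpandStep n (T : ntree n) (p : PB n) k : k < n ->
    expand_step (triple T p) (triple (attach T k) (kappa k p)).

Definition triple_rel : rel triples :=
  fun x y => `[< clos_refl_sym_trans _ expand_step x y >].

Lemma triple_rel_refl : reflexive triple_rel.
Proof. by move=> u; apply/asboolP; apply: rst_refl. Qed.

Lemma triple_rel_sym : symmetric triple_rel.
Proof. by move=> u v; apply/idP/idP => /asboolP h; apply/asboolP; apply: rst_sym. Qed.

Lemma triple_rel_trans : transitive triple_rel.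
Proof.
move=> v u w /asboolP huv /asboolP hvw; apply/asboolP; exact: rst_trans huv hvw.
Qed.

Canonical triple_equiv :=
  EquivRel triple_rel triple_rel_refl triple_rel_sym triple_rel_trans.

Definition Pbr := {eq_quot triple_equiv}.
HB.instance Definition _ := Choice.on Pbr.
HB.instance Definition _ := EqQuotient.on Pbr.

Definition pbr n (T : ntree n) (p : PB n) : Pbr := \pi_Pbr (triple T p).

Lemma pi_pbrP x y :
  clos_refl_sym_trans _ expand_step x y <-> \pi_Pbr x = \pi_Pbr y.
Proof. by split=> [h|/eqmodP/asboolP//]; apply/eqmodP/asboolP. Qed.

Lemma pbr_attach n (T : ntree n) (p : PB n) k : k < n ->
  pbr (attach T k) (kappa k p) = pbr T p.
Proof. by move=> kn; apply/pi_pbrP/rst_sym/rst_step. Qed.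

Fixpoint tree_le (T V : tree) : bool :=
  match T, V with
  | Leaf, _ => true
  | Node l r, Node l' r' => tree_le l l' && tree_le r r'
  | Node _ _, Leaf => false
  end.

Fixpoint tree_join (T V : tree) : tree :=
  match T, V with
  | Leaf, _ => V
  | Node _ _, Leaf => T
  | Node l r, Node l' r' => Node (tree_join l l') (tree_join r r')
  end.

Lemma tree_le_refl T : tree_le T T.
Proof. by elim: T => //= l -> r ->. Qed.

Lemma tree_le_trans T U V : tree_le T U -> tree_le U V -> tree_le T V.
Proof.
elim: T U V => // l IHl r IHr [] //= l' r' [] //= l'' r''.
by move=> /andP[/IHl h /IHr h'] /andP[/h-> /h'->].
Qed.

Lemma tree_le_joinl T V : tree_le T (tree_join T V).
Proof.
by elim: T V => // l IHl r IHr [|l' r'] /=; rewrite ?tree_le_refl // IHl IHr.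
Qed.

Lemma tree_le_joinr T V : tree_le V (tree_join T V).
Proof.
elim: T V => [|l IHl r IHr] [|l' r'] //=; rewrite ?tree_le_refl //.
by rewrite IHl IHr.
Qed.

Lemma tree_le_attach T k : tree_le T (attach_tree T k).
Proof.
elim: T k => //= l IHl r IHr k.
by case: ifP => _; rewrite tree_le_refl ?IHl ?IHr.
Qed.

Lemma nleaves_gt0 T : 0 < nleaves T.
Proof. by elim: T => //= l lP r rP; rewrite addn_gt0 lP. Qed.

Lemma tree_le_nleaves T V : tree_le T V -> nleaves T <= nleaves V.
Proof.
elim: T V => [V _|l IHl r IHr [] //= l' r' /andP[/IHl h /IHr h']].
  exact: nleaves_gt0.
exact: leq_add.
Qed.

Lemma tree_le_step T V : tree_le T V ->
  T = V \/ exists2 k, k < nleaves T & tree_le (attach_tree T k) V.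
Proof.
elim: T V => [[|l r] _|l IHl r IHr [] //= l' r' /andP[hl hr]]; first by left.
  by right; exists 0.
case: (IHl _ hl) => [->|[k kl hk]]; last first.
  right; exists k; first by rewrite ltn_addr.
  by rewrite kl /= hk.
case: (IHr _ hr) => [->|[k kr hk]]; first by left.
right; exists (nleaves l' + k); first by rewrite ltn_add2l.
by rewrite ltnNge leq_addr /= addKn tree_le_refl.
Qed.

(* The successive leaves to which carets are attached to get from [T] to [V],
   with the numbering of the leaves shifted by [o]. *)
Fixpoint leaf_path (V : tree) (o : nat) : seq nat :=
  if V is Node l r then o :: leaf_path r o.+1 ++ leaf_path l o else [::].

Fixpoint tree_path (T V : tree) (o : nat) : seq nat :=
  match T, V with
  | Leaf, _ => leaf_path V o
  | Node _ _, Leaf => [::]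
  | Node l r, Node l' r' => tree_path r r' (o + nleaves l) ++ tree_path l l' o
  end.

Lemma tree_path_refl T o : tree_path T T o = [::].
Proof. by elim: T o => //= l IHl r IHr o; rewrite IHl IHr. Qed.

Lemma leaf_pathS V o : leaf_path V o.+1 = [seq u.+1 | u <- leaf_path V o].
Proof. by elim: V o => //= l IHl r IHr o; rewrite map_cat IHr IHl. Qed.

Lemma tree_pathS T V o : tree_path T V o.+1 = [seq u.+1 | u <- tree_path T V o].
Proof.
elim: T V o => [|l IHl r IHr]; first exact: leaf_pathS.
by case=> //= l' r' o; rewrite map_cat -IHl -IHr addSn.
Qed.

Lemma leaf_path_ge V o : all (leq o) (leaf_path V o).
Proof.
elim: V o => //= l IHl r IHr o; rewrite leqnn all_cat IHl andbT.
by apply: sub_all (IHr _) => u; apply: ltnW.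
Qed.

Lemma tree_path_ge T V o : all (leq o) (tree_path T V o).
Proof.
elim: T V o => [|l IHl r IHr]; first exact: leaf_path_ge.
case=> //= l' r' o; rewrite all_cat IHl andbT.
by apply: sub_all (IHr _ _) => u; apply: leq_trans; apply: leq_addr.
Qed.

Definition clones (ks : seq nat) (x : {n & PB n}) : {n & PB n} :=
  foldl (fun x k => Tagged PB (kappa k (tagged x))) x ks.

Arguments clones : simpl never.

Lemma clones_shift c us x : all (leq c.+1) us ->
  clones (us ++ [:: c]) x = clones (c :: [seq u.+1 | u <- us]) x.
Proof.
elim: us x => [//|u us IHus] x /= /andP[cu cus]; have IH := IHus _ cus.
rewrite -[LHS]/(clones (us ++ [:: c]) _) IH.
by rewrite /clones /= kappa_kappa.
Qed.

Lemma clones_cat us vs x : clones (us ++ vs) x = clones vs (clones us x).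
Proof. exact: foldl_cat. Qed.

Lemma clones_path T V k o x : k < nleaves T -> tree_le (attach_tree T k) V ->
  clones (tree_path T V o) x =
  clones ((o + k) :: tree_path (attach_tree T k) V o) x.
Proof.
elim: T V k o x => [|l IHl r IHr] [|l' r'] k o x //.
- rewrite ltnS leqn0 => /eqP-> _.
  by rewrite /= addn0 addn1.
- by move=> _ /=; case: ifP.
rewrite /=; case: (ltnP k (nleaves l)) => [kl _|lk kr] /= /andP[hl hr].
  rewrite clones_cat (IHl _ _ _ _ kl hl) nleaves_attach addnS tree_pathS.
  rewrite -[_ :: _ ++ _]cat1s -clones_cat -[_ :: _]cat1s catA clones_cat.
  rewrite clones_shift; last first.
    apply: sub_all (tree_path_ge r r' _) => u; apply: leq_trans.
    by rewrite ltn_add2l.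
  by rewrite cat1s -clones_cat.
rewrite clones_cat (IHr r' (k - nleaves l)) //; last by rewrite ltn_subLR.
by rewrite -addnA subnKC // -clones_cat.
Qed.

Lemma Tagged_inj (A : nat -> Type) n : injective (fun x : A n => Tagged A x).
Proof. by move=> x y; apply: eq_from_Tagged. Qed.

(* The morphism of the direct system from the tree [T] to the tree [V]. *)
Lemma expansion n (T : ntree n) m (V : ntree m) : tree_le (val T) (val V) ->
  exists f : PB n -> PB m, [/\ {morph f : p q / p * q},
    forall p, Tagged PB (f p) = clones (tree_path (val T) (val V) 0) (Tagged PB p)
    & forall p, pbr T p = pbr V (f p)].
Proof.
move: {2}(m - n) (erefl (m - n)) => d.
elim: d n T => [|d IHd] n T md TV;
    have [eTV|[k kT hk]] := tree_le_step TV.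
- have e : n = m by rewrite -(eqP (valP T)) eTV (eqP (valP V)).
  case: m / e V {md TV} eTV => V /val_inj <-.
  by exists id; split=> // p; rewrite tree_path_refl.
- have := tree_le_nleaves hk; rewrite nleaves_attach (eqP (valP T)).
  by rewrite (eqP (valP V)); lia.
- have e : n = m by rewrite -(eqP (valP T)) eTV (eqP (valP V)).
  by lia.
have kn : k < n by rewrite -(eqP (valP T)).
have [|f [fM fP fE]] := IHd n.+1 (attach T k) _ hk; first by lia.
exists (f \o kappa k); split=> [p q|p|p] /=; first by rewrite kappaM fM.
  by rewrite fP (clones_path _ _ kT hk) add0n.
by rewrite -fE pbr_attach.
Qed.

Definition ntree_of (T : tree) : ntree (nleaves T) :=
  exist (fun U => nleaves U == nleaves T) T (eqxx _).

Lemma pbr_common x y : exists n (T : ntree n) p q, x = pbr T p /\ y = pbr T q.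
Proof.
rewrite -[x]reprK -[y]reprK; case: (repr x) (repr y) => n [T p] [m [U q]].
pose V := ntree_of (tree_join (val T) (val U)).
have [f [_ _ fE]] := @expansion n T _ V (tree_le_joinl _ _).
have [g [_ _ gE]] := @expansion m U _ V (tree_le_joinr _ _).
exists _, V, (f p), (g q); split; [exact: fE|exact: gE].
Qed.

Definition triple_at (x : triples) (V : tree) : {n & PB n} :=
  clones (tree_path (val (tagged x).1) V 0) (Tagged PB (tagged x).2).

Lemma pbr_eventually x y : \pi_Pbr x = \pi_Pbr y -> exists V0, forall V,
  tree_le V0 V -> [/\ tree_le (val (tagged x).1) V,
     tree_le (val (tagged y).1) V & triple_at x V = triple_at y V].
Proof.
move/pi_pbrP; elim=> {x y}.
- move=> _ _ [n T p k kn]; exists (attach_tree (val T) k) => V hV; split=> //=.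
    exact: tree_le_trans (tree_le_attach _ _) hV.
  by rewrite /triple_at /= (@clones_path _ _ k) ?(eqP (valP T)) // add0n.
- by move=> x; exists (val (tagged x).1).
- by move=> x y _ [V0 h]; exists V0 => V /h[].
move=> x y z _ [V0 h] _ [V1 h']; exists (tree_join V0 V1) => V hV.
have [hx _ exy] := h V (tree_le_trans (tree_le_joinl _ _) hV).
have [_ hz eyz] := h' V (tree_le_trans (tree_le_joinr _ _) hV).
by split; rewrite // exy.
Qed.

Lemma pbrM_wd n (T : ntree n) p q m (U : ntree m) p' q' :
    pbr T p = pbr U p' -> pbr T q = pbr U q' ->
  pbr T (p * q) = pbr U (p' * q').
Proof.
move=> /pbr_eventually[V0 h0] /pbr_eventually[V1 h1].
pose V := ntree_of (tree_join V0 V1).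
have [/= TV UV ep] := h0 (val V) (tree_le_joinl _ _).
have [_ _ eq] := h1 (val V) (tree_le_joinr _ _).
have [f [fM fP fE]] := @expansion n T _ V TV.
have [g [gM gP gE]] := @expansion m U _ V UV.
rewrite fE gE fM gM; congr (pbr V (_ * _)); apply: (@Tagged_inj PB);
  rewrite fP gP; [exact: ep|exact: eq].
Qed.

Lemma pbr_mul_subproof (xy : Pbr * Pbr) :
  exists z : {n & (ntree n * (PB n * PB n))%type},
    (xy.1 == pbr (tagged z).1 (tagged z).2.1) &&
    (xy.2 == pbr (tagged z).1 (tagged z).2.2).
Proof.
case: xy => x y; have [n [T [p [q [-> ->]]]]] := pbr_common x y.
by exists (Tagged (fun n => ntree n * (PB n * PB n))%type (T, (p, q))); rewrite !eqxx.
Qed.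

(* The product is computed in chosen representatives with a common tree; it does
   not depend on the choice, by [pbr_mulE]. *)
Definition pbr_mul (x y : Pbr) : Pbr :=
  let z := tagged (xchoose (pbr_mul_subproof (x, y))) in
  pbr z.1 (z.2.1 * z.2.2).

Lemma pbr_mulE n (T : ntree n) p q :
  pbr_mul (pbr T p) (pbr T q) = pbr T (p * q).
Proof.
rewrite /pbr_mul.
have /andP[/eqP ep /eqP eq] := xchooseP (pbr_mul_subproof (pbr T p, pbr T q)).
exact/esym/pbrM_wd.
Qed.

Definition leaf_tree : ntree 1%N := ntree_of Leaf.

Definition pbr_one : Pbr := pbr leaf_tree 1.

Lemma pbr1 n (T : ntree n) : pbr T 1 = pbr_one.
Proof.
have [f [fM _ fE]] := @expansion _ leaf_tree _ T erefl.
rewrite /pbr_one fE; congr (pbr T _).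
by apply: (mulIg (f 1)); rewrite -fM !mul1g.
Qed.

Definition pbr_inv (x : Pbr) : Pbr :=
  pbr (tagged (repr x)).1 (tagged (repr x)).2^-1.

Lemma pbr_rep x : exists n (T : ntree n) p, x = pbr T p.
Proof. by have [n [T [p [_ [-> _]]]]] := pbr_common x x; exists n, T, p. Qed.

Lemma pbr_repr x : x = pbr (tagged (repr x)).1 (tagged (repr x)).2.
Proof. by rewrite -[LHS]reprK; case: (repr x) => n []. Qed.

Lemma pbr_mulA : associative pbr_mul.
Proof.
move=> x y z; have [n [T [p [q [-> ->]]]]] := pbr_common x y.
have [m [U [r ->]]] := pbr_rep z.
pose V := ntree_of (tree_join (val T) (val U)).
have [f [_ _ fE]] := @expansion n T _ V (tree_le_joinl _ _).
have [g [_ _ gE]] := @expansion m U _ V (tree_le_joinr _ _).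
by rewrite !fE !gE !pbr_mulE mulgA.
Qed.

Lemma pbr_mul1 : left_id pbr_one pbr_mul.
Proof.
by move=> x; have [n [T [p ->]]] := pbr_rep x; rewrite -(pbr1 T) pbr_mulE mul1g.
Qed.

Lemma pbr_1mul : right_id pbr_one pbr_mul.
Proof.
by move=> x; have [n [T [p ->]]] := pbr_rep x; rewrite -(pbr1 T) pbr_mulE mulg1.
Qed.

Lemma pbr_mulV : left_inverse pbr_one pbr_inv pbr_mul.
Proof.
move=> x; rewrite [X in pbr_mul _ X]pbr_repr /pbr_inv pbr_mulE mulVg; exact: pbr1.
Qed.

Lemma pbr_Vmul : right_inverse pbr_one pbr_inv pbr_mul.
Proof.
move=> x; rewrite [X in pbr_mul X _]pbr_repr /pbr_inv pbr_mulE mulgV; exact: pbr1.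
Qed.

HB.instance Definition _ := isGroup.Build Pbr pbr_mulA pbr_mul1 pbr_1mul
  pbr_mulV pbr_Vmul.

Lemma pbrM n (T : ntree n) p q : pbr T p * pbr T q = pbr T (p * q).
Proof. exact: pbr_mulE. Qed.

(* Main.v *)
Require Import Defs.
From HB Require Import structures.
From mathcomp Require Import all_boot.
From mathcomp Require Import boolp zify.
From mathcomp Require Import ssralg ssrint.

Set Implicit Arguments.
Unset Strict Implicit.
Unset Printing Implicit Defensive.

Local Open Scope group_scope.
Local Open Scope quotient_scope.

(** Cutting a tree down to its left subtree and deleting all strands that end
    at leaves of the right subtree gives an endomorphism of [Pbr]: the triple
    of [Node l r] and [p] is sent to the triple of [l] and the braid left of
    [p] when only its first [nleaves l] strands are kept, and the triples of
    the one-vertex tree are sent to 1.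

    - It respects expansion: doubling a strand that is kept commutes with the
      deletion ([restrict_kappa_lt]), and doubling a strand that is deleted
      does not change the outcome ([restrict_kappa_ge]).
    - It is surjective, since adding a right leaf with a trivial strand to any
      triple gives a preimage of it ([forget_right_surj]).
    - It kills the full twist of two strands carried by the caret, because a
      single strand is left.  This element of [Pbr] is not trivial: the
      cloning maps are injective, as deleting the new copy undoes the doubling
      ([kappa_inj]), so the pure braid group at each tree embeds in the direct
      limit ([pbr_inj]), and the full twist has exponent sum 2 in the braid
      group on two strands ([full_twist_neq1]).

    The work is in the deletion of strands.  It is defined on words, for an
    arbitrary set [A] of kept positions that moves along with the strands, so
    that it is a cocycle: [forget_cat].  Hence only the Artin relations
    themselves matter for braids ([forget_artin]), and the relations with
    cloning need only be checked on one letter. *)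

(** * Sets of kept positions *)

Definition rank (A : pred nat) (i : nat) : nat := count A (iota 0 i).

Lemma rankS A i : rank A i.+1 = rank A i + A i.
Proof. by rewrite /rank -addn1 iotaD count_cat /= addn0. Qed.

Lemma leq_rank A i j : i <= j -> rank A i <= rank A j.
Proof. by move=> /subnKC <-; rewrite /rank iotaD count_cat leq_addr. Qed.

Lemma eq_rank A B i : (forall j, j < i -> A j = B j) -> rank A i = rank B i.
Proof. by move=> AB; apply: eq_in_count => j; rewrite mem_iota => /AB. Qed.

(** The positions of the kept strands after a crossing of the strands in
    positions [i] and [i.+1]. *)
Definition exchange i (A : pred nat) : pred nat := A \o swap i.

(** The two positions that are exchanged lie on the same side of any other
    cut. *)
Lemma rank_exchange A i j : j != i.+1 -> rank (exchange i A) j = rank A j.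
Proof.
move=> ji; case: (ltnP i j) => [ij|ji'].
  have lt_ij : i.+1 < j by rewrite ltn_neqAle eq_sym ji.
  rewrite -(subnKC lt_ij) /rank !iotaD !count_cat add0n; congr (_ + _); last first.
    apply: eq_in_count => a; rewrite mem_iota => /andP[ia _].
    by rewrite /exchange /= swap_id ?ia ?orbT.
  rewrite -[LHS]/(rank _ _) -[RHS]/(rank _ _) !rankS /exchange /= swap0 swapS.
  rewrite (@eq_rank _ A) => [|a ai]; last by rewrite /= swap_id ?ai.
  by rewrite -!addnA (addnC (A i)).
by apply: eq_rank => a aj; rewrite /exchange /= swap_id // (leq_trans aj).
Qed.

(** That [A] has at most [m] elements: the kept strands fit in [braid m]. *)
Definition at_most m (A : pred nat) : Prop := forall j, rank A j <= m.

Lemma at_most_exchange m i A : at_most m A -> at_most m (exchange i A).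
Proof.
move=> Am j; case: (eqVneq j i.+1) => [->|/rank_exchange-> //].
by apply: leq_trans (leq_rank _ (leqnSn _)) _; rewrite rank_exchange //; lia.
Qed.

(** * Deleting strands from a braid *)

Definition cross m i b : braid m := if b then (sg m i)^-1 else sg m i.

(** A crossing survives when both of its strands are kept, and is then renumbered
    by the number of kept strands to its left. *)
Definition forget_letter m (A : pred nat) (i : nat) (b : bool) : braid m :=
  if A i && A i.+1 then cross m (rank A i) b else 1.

Fixpoint forget_word n m (A : pred nat) (w : word n) : braid m :=
  if w is (i, b) :: w' then
    forget_letter m A i b * forget_word m (exchange i A) w'
  else 1.

(** The positions at the bottom of [w] of the strands that are kept. *)
Fixpoint push n (w : word n) (A : pred nat) : pred nat :=
  if w is l :: w' then push w' (exchange l.1 A) else A.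

Lemma forget_cat n m A (u v : word n) :
  forget_word m A (u ++ v) = forget_word m A u * forget_word m (push u A) v.
Proof.
by elim: u A => [|[i b] u IHu] A /=; rewrite ?mul1g // IHu mulgA.
Qed.

Lemma at_most_push n (w : word n) m A : at_most m A -> at_most m (push w A).
Proof. by elim: w A => //= l w IHw A /at_most_exchange/IHw. Qed.

Lemma push_track n (w : word n) A k : push w A (track w k) = A k.
Proof. by elim: w A k => //= l w IHw A k; rewrite IHw /exchange /= swapK. Qed.

Lemma track_surj n (w : word n) k : exists j, track w j = k.
Proof.
elim: w k => [|l w IHw] k /=; first by exists k.
by have [j <-] := IHw k; exists (swap l.1 j); rewrite swapK.
Qed.

(** [push] is determined by [track], which respects the Artin relations. *)
Lemma push_artin n (u v : word n) A : artin u v -> push u A = push v A.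
Proof.
move=> uv; apply/funext=> k; have [j <-] := track_surj u k.
by rewrite push_track (track_artin _ uv) push_track.
Qed.

(** If fewer than all the strands of a relation are kept, both sides reduce to
    the same letter or to nothing; otherwise the relation survives, renumbered.
    The bound on [A] serves the braid relation, where three kept strands need
    the last of their two generators to exist in [braid m]. *)
Lemma forget_artin n m A (u v : word n) : at_most m A -> artin u v ->
  forget_word m A u = forget_word m A v.
Proof.
move=> Am [i b|i j ij|i j ij] /=; rewrite ?mulg1.
- rewrite /forget_letter rank_exchange; last lia.
  rewrite /exchange /= swap0 swapS andbC; case: ifP; rewrite ?mulg1 // => _.
  by rewrite /cross; case: b; rewrite ?mulVg ?mulgV.
- rewrite /forget_letter !rank_exchange /exchange /=; try lia.
  rewrite (@swap_id i j) ?ij ?orbT // (@swap_id i j.+1); last lia.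
  rewrite (@swap_id j i) ?(@swap_id j i.+1); try lia.
  case: (boolP (A i && A i.+1)) => [/andP[Ai Ai1]|_]; last by rewrite mulg1 mul1g.
  case: ifP => _; rewrite ?mulg1 ?mul1g //.
  apply: sg_comm; apply: leq_trans (leq_rank _ ij).
  by rewrite !rankS Ai Ai1 !addn1.
rewrite ij /forget_letter !(rankS _ i) !rank_exchange; try lia.
rewrite /exchange /= !swapS !swap0 !(@swap_id i i.+2) ?ltnS ?leqnn ?orbT //.
rewrite !(@swap_id i.+1 i) ?leqnn // !swap0 !swapS.
have := Am i.+3; rewrite !rankS; move: (rank A i) => c.
case: (A i); case: (A i.+1); case: (A i.+2);
  rewrite /= ?mulg1 ?mul1g // ?addn1 ?addn0 => cm //.
by rewrite !mulgA sg_braid.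
Qed.

Definition forget n m (A : pred nat) (x : braid n) : braid m :=
  forget_word m A (repr x).

Lemma forget_pi n m A (w : word n) : at_most m A ->
  forget m A (\pi_(braid n) w) = forget_word m A w.
Proof.
move=> Am; apply: (@braid_lift n _ (fun w => forget_word m A w)); last by rewrite reprK.
move=> p s u v uv; rewrite !forget_cat (forget_artin _ uv) ?(push_artin _ uv) //.
exact: at_most_push.
Qed.

(** In general the second factor keeps the moved set of positions; a pure braid
    does not move it. *)
Lemma forgetM n m A (x y : braid n) : at_most m A -> pure n x ->
  forget m A (x * y) = forget m A x * forget m A y.
Proof.
move=> Am xP; rewrite -{1}[x]reprK -{1}[y]reprK -pi_cat forget_pi // forget_cat.
congr (_ * forget_word m _ _); apply/funext=> k.
by rewrite -{1}(strand_pure k xP) push_track.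
Qed.

(** * Deletion and cloning *)

(** The strand, before strand [k] is doubled, from which the strand in position
    [j] comes. *)
Definition unshift_pos (k j : nat) : nat := if k < j then j.-1 else j.

(** The two sets of positions kept after strand [k] is doubled: with
    [both_copies] both copies share the fate of strand [k], whereas with
    [left_copy] only the left one does and the right one is deleted, which
    undoes the doubling. *)
Definition both_copies k (A : pred nat) (j : nat) : bool := A (unshift_pos k j).

Definition left_copy k (A : pred nat) (j : nat) : bool :=
  (j != k.+1) && A (unshift_pos k j).

Lemma rank_both_copies k (A : pred nat) j : A k ->
  rank (both_copies k A) j = rank A (unshift_pos k j) + (k < j).
Proof.
move=> Ak; elim: j => [//|j IHj].
rewrite rankS IHj /both_copies /unshift_pos.
case: (ltngtP k j) => [kj|jk|<-] /=.
- by rewrite ltnW //; case: j kj {IHj} => // j kj /=; rewrite rankS; lia.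
- by rewrite ltnNge jk rankS; lia.
- by rewrite ltnSn Ak; lia.
Qed.

Lemma rank_left_copy k A j : rank (left_copy k A) j = rank A (unshift_pos k.+1 j).
Proof.
elim: j => [//|j IHj].
rewrite rankS IHj /left_copy /unshift_pos.
case: (ltngtP k.+1 j) => [kj|jk|<-] /=.
- by do ?(case: ifP; [move=> _|lia]); case: j kj {IHj} => // j kj /=; rewrite rankS.
- by do ?(case: ifP; [lia|move=> _]); rewrite rankS.
- by rewrite ltnSn addn0.
Qed.

Lemma at_most_both_copies m k (A : pred nat) :
  A k -> at_most m A -> at_most m.+1 (both_copies k A).
Proof.
by move=> Ak Am j; rewrite rank_both_copies //; have := Am (unshift_pos k j); lia.
Qed.

Lemma at_most_left_copy m k A : at_most m A -> at_most m (left_copy k A).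
Proof. by move=> Am j; rewrite rank_left_copy. Qed.

(** The left copy of the doubled strand stays left of the right copy. *)
Lemma push_clone_letter_left n k A (l : letter n) :
  push (clone_letter k l) (left_copy k A) = left_copy (swap l.1 k) (exchange l.1 A).
Proof.
case: l => i b; apply/funext=> j; rewrite /clone_letter.
case: (swap_cases i k) => -[h ->]; (repeat case: ifP); try lia;
  rewrite /= /left_copy /exchange /= /unshift_pos /swap => *; congr (_ && A _);
  (repeat case: ifP); lia.
Qed.

Lemma push_clone_letter_both n k A (l : letter n) :
  push (clone_letter k l) (both_copies k A) = both_copies (swap l.1 k) (exchange l.1 A).
Proof.
case: l => i b; apply/funext=> j; rewrite /clone_letter.
case: (swap_cases i k) => -[h ->]; (repeat case: ifP); try lia;
  rewrite /= /both_copies /exchange /= /unshift_pos /swap => *; congr (A _);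
  (repeat case: ifP); lia.
Qed.

Lemma eq_forget_letter m A B i j b : A i = B j -> A i.+1 = B j.+1 ->
  rank A i = rank B j -> forget_letter m A i b = forget_letter m B j b.
Proof. by rewrite /forget_letter => -> -> ->. Qed.

Lemma forget_letter1 m (A : pred nat) i b :
  ~~ (A i && A i.+1) -> forget_letter m A i b = 1.
Proof. by rewrite /forget_letter => /negbTE->. Qed.

Lemma left_copy_le k A j : j <= k -> left_copy k A j = A j.
Proof. by move=> jk; rewrite /left_copy /unshift_pos ltnNge jk; case: eqP => //; lia. Qed.

Lemma left_copyS k A : left_copy k A k.+1 = false.
Proof. by rewrite /left_copy eqxx. Qed.

Lemma left_copy_gt k A j : k < j -> left_copy k A j.+1 = A j.
Proof. by move=> kj; rewrite /left_copy /unshift_pos ltnS ltnW // eqSS gtn_eqF. Qed.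

Lemma rank_left_le k A j : j <= k.+1 -> rank (left_copy k A) j = rank A j.
Proof. by move=> jk; rewrite rank_left_copy /unshift_pos ltnNge jk. Qed.

Lemma rank_left_gt k A j : k < j -> rank (left_copy k A) j.+1 = rank A j.
Proof. by move=> kj; rewrite rank_left_copy /unshift_pos ltnS kj. Qed.

(** Of the two letters that clone a crossing of strand [k], the one that involves
    the right copy is deleted, and the other has the original rank. *)
Lemma forget_clone_letter_left n m k A (l : letter n) :
  forget_word m (left_copy k A) (clone_letter k l) = forget_word m A [:: l].
Proof.
case: l => i b; rewrite /clone_letter /= mulg1.
case: (gen_cases i k) => h; (repeat (case: ifP => ?; try lia)); rewrite /= mulg1.
- by apply: eq_forget_letter; rewrite ?left_copy_gt ?rank_left_gt //; lia.
- subst k; rewrite forget_letter1 ?left_copyS // mul1g.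
  apply: eq_forget_letter; rewrite ?rank_exchange ?rank_left_le /exchange /= ?swap0; try lia.
    by rewrite swap_id ?leqnn // left_copy_le.
  by rewrite left_copy_gt.
- subst k; rewrite [X in _ * X]forget_letter1 ?mulg1; last first.
    by rewrite /exchange /= swapS (@swap_id i i.+2) ?leqnn ?orbT // left_copyS andbF.
  by apply: eq_forget_letter; rewrite ?rank_left_le ?left_copy_le //; lia.
- by apply: eq_forget_letter; rewrite ?rank_left_le ?left_copy_le //; lia.
Qed.

Lemma forget_clone_left n m k A (x : braid n) : at_most m A ->
  forget m (left_copy k A) (clone k x) = forget m A x.
Proof.
move=> Am; rewrite -[x]reprK clone_pi !forget_pi //; last exact: at_most_left_copy.
elim: (repr x) k A Am => //= l w IHw k A Am.
rewrite forget_cat forget_clone_letter_left push_clone_letter_left.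
rewrite IHw; last exact: at_most_exchange.
by case: l => i b /=; rewrite mulg1.
Qed.

Lemma crossE n i b (lt_i : i < n.-1) :
  cross n i b = \pi_(braid n) [:: (Ordinal lt_i, b)].
Proof. by rewrite pi_letter. Qed.

Lemma clone_cross n k i b : i < n.-1 ->
  clone k (cross n i b) =
  if k < i then cross n.+1 i.+1 b
  else if k == i then cross n.+1 i.+1 b * cross n.+1 i b
  else if k == i.+1 then cross n.+1 i b * cross n.+1 i.+1 b
  else cross n.+1 i b.
Proof.
move=> lt_i; rewrite (crossE b lt_i) clone_pi /= cats0.
have pi2 (a c : letter n.+1) :
  \pi_(braid n.+1) [:: a; c] = \pi_(braid n.+1) [:: a] * \pi_(braid n.+1) [:: c].
  by rewrite -pi_cat.
by rewrite /clone_letter; do 3?case: ifP => _; rewrite ?pi2 !pi_letter.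
Qed.

Lemma strand_cross n i b k : i < n.-1 -> strand (cross n i b) k = swap i k.
Proof.
by move=> lt_i; rewrite (crossE b lt_i) strand_pi.
Qed.

(** Where a crossing survives, its renumbered generator exists in [braid m]. *)
Lemma rank_crossing m (A : pred nat) i :
  at_most m A -> A i -> A i.+1 -> rank A i < m.-1.
Proof. by move=> Am Ai Ai1; have := Am i.+2; rewrite !rankS Ai Ai1; lia. Qed.

(** Deletion preserves the order of the kept strands, so the kept strand [k]
    becomes strand [rank A k], also below the crossing. *)
Lemma strand_forget_letter m (A : pred nat) i b k : at_most m A -> A k ->
  strand (forget_letter m A i b) (rank A k) = rank (exchange i A) (swap i k).
Proof.
move=> Am Ak; rewrite /forget_letter.
case: (swap_cases i k) => -[h ->].
- rewrite rankS rank_exchange; last lia. subst k.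
  rewrite Ak /exchange /= swap0; case: ifP => Ai1; last by rewrite strand1 addn0.
  by rewrite strand_cross ?rank_crossing // swap0 addn1.
- subst k; rewrite rank_exchange; last lia.
  rewrite Ak andbT rankS; case: ifP => Ai; last by rewrite strand1 addn0.
  by rewrite strand_cross ?rank_crossing // addn1 swapS.
rewrite rank_exchange; last lia.
case: ifP => [/andP[Ai Ai1]|_]; last by rewrite strand1.
rewrite strand_cross ?rank_crossing // swap_id //.
case: h => h; apply/orP; [left|right].
  by have := leq_rank A h; rewrite rankS Ak; lia.
by have := leq_rank A h; rewrite !rankS Ai Ai1; lia.
Qed.

(** A crossing that survives relates to strand [rank A k] as the original one to
    strand [k], because ranks of kept positions preserve the order; so both
    sides are cloned in the same way. *)
Lemma forget_clone_letter_both n m k (A : pred nat) (l : letter n) :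
    at_most m A -> A k ->
  forget_word m.+1 (both_copies k A) (clone_letter k l) =
  clone (rank A k) (forget_word m A [:: l]).
Proof.
move=> Am Ak; case: l => i b; rewrite /clone_letter /= mulg1.
have rE j : j <= k -> rank (both_copies k A) j = rank A j.
  by move=> jk; rewrite rank_both_copies // /unshift_pos ltnNge jk addn0.
have rE1 j : k <= j -> rank (both_copies k A) j.+1 = (rank A j).+1.
  by move=> kj; rewrite rank_both_copies // /unshift_pos ltnS kj addn1.
have bE j : j <= k -> both_copies k A j = A j.
  by move=> jk; rewrite /both_copies /unshift_pos ltnNge jk.
have bE1 j : k <= j -> both_copies k A j.+1 = A j.
  by move=> kj; rewrite /both_copies /unshift_pos ltnS kj.
(* [clone_cross] at the renumbered crossing. *)
have cE c : A i -> A i.+1 -> clone c (cross m (rank A i) b) =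
  if c < rank A i then cross m.+1 (rank A i).+1 b
  else if c == rank A i then
    cross m.+1 (rank A i).+1 b * cross m.+1 (rank A i) b
  else if c == (rank A i).+1 then
    cross m.+1 (rank A i) b * cross m.+1 (rank A i).+1 b
  else cross m.+1 (rank A i) b.
  by move=> Ai Ai1; rewrite clone_cross ?rank_crossing.
case: (gen_cases i k) => h; (repeat (case: ifP => ?; try lia)); rewrite /= ?mulg1.
- rewrite /forget_letter !bE1 ?rE1; try lia.
  case: ifP => [/andP[Ai Ai1]|]; rewrite ?clone1 // cE // ifT //.
  by have := leq_rank A h; rewrite rankS Ak; lia.
- subst k; rewrite /forget_letter rank_exchange; last lia.
  rewrite /exchange /= swap0 (@swap_id _ i) ?leqnn // !bE1 ?rE1 ?bE ?rE //; try lia.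
  by case: ifP => [/andP[Ai Ai1]|]; rewrite ?clone1 ?mulg1 // cE // ltnn eqxx.
- subst k; rewrite /forget_letter (rankS _ i) rank_exchange; last lia.
  rewrite /exchange /= swap0 swapS (@swap_id i i.+2) ?leqnn ?orbT //.
  rewrite (bE1 i.+1) // (bE i) // (bE i.+1) // rE //.
  rewrite Ak addn1 andbT.
  case: ifP => Ai; rewrite ?clone1 ?mulg1 // cE // rankS Ai addn1 eqxx.
  by rewrite ltnNge leqnSn gtn_eqF.
- rewrite /forget_letter !bE ?rE; try lia.
  case: ifP => [/andP[Ai Ai1]|]; rewrite ?clone1 // cE // !ifN //.
  all: by have := leq_rank A h; rewrite !rankS Ai Ai1; lia.
Qed.

(** Both sides are cocycles in [x], with [strand_forget_letter] matching the
    doubled strands as they move; so letters suffice. *)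
Lemma forget_clone_both n m k (A : pred nat) (x : braid n) :
    at_most m A -> A k ->
  forget m.+1 (both_copies k A) (clone k x) = clone (rank A k) (forget m A x).
Proof.
move=> Am Ak; rewrite -[x]reprK clone_pi !forget_pi //; last exact: at_most_both_copies.
elim: (repr x) k A Am Ak => [|l w IHw] k A Am Ak; first by rewrite clone1.
rewrite -[clone_word _ _]/(clone_letter k l ++ clone_word (swap l.1 k) w).
rewrite forget_cat forget_clone_letter_both // push_clone_letter_both.
rewrite IHw; [|exact: at_most_exchange|by rewrite /exchange /= swapK].
by case: l => i b; rewrite /= mulg1 cloneM strand_forget_letter.
Qed.

(** * Keeping the first strands of a pure braid *)

Definition initial m : pred nat := fun j => j < m.

Lemma rank_initial m j : rank (initial m) j = minn j m.
Proof. by elim: j => [|j IHj]; rewrite ?min0n // rankS IHj /initial; lia. Qed.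

Lemma at_most_initial m : at_most m (initial m).
Proof. by move=> j; rewrite rank_initial geq_minr. Qed.

Lemma left_copy_initial m k : m <= k -> left_copy k (initial m) = initial m.
Proof.
move=> mk; apply/funext=> j; rewrite /left_copy /initial /unshift_pos.
by case: ifP; lia.
Qed.

Lemma both_copies_initial m k : k < m -> both_copies k (initial m) = initial m.+1.
Proof.
move=> mk; apply/funext=> j; rewrite /both_copies /initial /unshift_pos.
by case: ifP; lia.
Qed.

Lemma exchange_initial m i : (i.+1 < m) || (m <= i) -> exchange i (initial m) = initial m.
Proof.
move=> im; apply/funext=> j; rewrite /exchange /initial /=.
by case: (swap_cases i j) => -[h ->]; lia.
Qed.

Lemma forget_all_kept n (x : braid n) : forget n (initial n) x = x.
Proof.
rewrite -[x]reprK forget_pi; last exact: at_most_initial.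
elim: (repr x) => [|[i b] w IHw] //=; have lt_i := ltn_ord i.
rewrite exchange_initial ?IHw; last lia.
rewrite -cat1s pi_cat pi_letter /forget_letter rank_initial /initial ifT; last lia.
by rewrite (minn_idPl _) //; lia.
Qed.

Lemma strand_forget n m (A : pred nat) (x : braid n) k :
    at_most m A -> A k -> pure n x ->
  strand (forget m A x) (rank A k) = rank A k.
Proof.
move=> Am Ak xP; rewrite -{1}[x]reprK forget_pi //.
suff -> : strand (forget_word m A (repr x)) (rank A k) =
   rank (push (repr x) A) (track (repr x) k).
  rewrite -[track _ _]/(strand x k) strand_pure //; congr (rank _ _).
  by apply/funext=> j; rewrite -{1}(strand_pure j xP) push_track.
elim: (repr x) k A Am Ak => [|[i b] w IHw] k A Am Ak; first by rewrite strand1.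
rewrite /= strandM strand_forget_letter // IHw //; first exact: at_most_exchange.
by rewrite /exchange /= swapK.
Qed.

Lemma forget_pure n m (x : braid n) : pure n x -> pure m (forget m (initial m) x).
Proof.
move=> xP; apply/pureP=> k km.
by have := strand_forget (at_most_initial m) km xP;
  rewrite rank_initial (minn_idPl _) // ltnW.
Qed.

Definition restrict n m (p : PB n) : PB m :=
  Sub (forget m (initial m) (val p)) (forget_pure m (valP p)).

Lemma restrictM n m : {morph @restrict n m : p q / p * q}.
Proof.
move=> p q; apply: val_inj; rewrite [RHS]valM /restrict !SubK.
by rewrite forgetM //; [exact: at_most_initial | exact: valP].
Qed.

Lemma restrict_kappa_lt n m k (p : PB n) : k < m ->
  restrict m.+1 (kappa k p) = kappa k (restrict m p).
Proof.
move=> km; apply: val_inj; rewrite val_kappa /restrict !SubK -(both_copies_initial km).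
rewrite forget_clone_both //; last exact: at_most_initial.
by rewrite rank_initial (minn_idPl _) // ltnW.
Qed.

Lemma restrict_kappa_ge n m k (p : PB n) : m <= k ->
  restrict m (kappa k p) = restrict m p.
Proof.
move=> mk; apply: val_inj; rewrite /restrict !SubK -{1}(left_copy_initial mk).
by rewrite forget_clone_left //; exact: at_most_initial.
Qed.

Lemma restrict_id n (p : PB n) : restrict n p = p.
Proof. by apply: val_inj; rewrite /restrict SubK forget_all_kept. Qed.

(** Deleting the right copy of the doubled strand is a left inverse. *)
Lemma kappa_inj n k : injective (@kappa n k).
Proof.
move=> p q /(congr1 val); rewrite !val_kappa.
move/(congr1 (forget n (left_copy k (initial n)))).
rewrite !forget_clone_left ?forget_all_kept; try exact: at_most_initial.
exact: val_inj.
Qed.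

Lemma clones_inj n (p q : PB n) ks :
  clones ks (Tagged PB p) = clones ks (Tagged PB q) -> p = q.
Proof.
elim: ks n p q => [|k ks IHks] n p q; first exact: Tagged_inj.
by move/IHks/kappa_inj.
Qed.

(** Equal elements of the direct limit become equal at some larger tree, and the
    maps of the direct system are injective. *)
Lemma pbr_inj n (T : ntree n) : injective (pbr T).
Proof.
move=> p q /pbr_eventually[V hV].
by have [_ _] := hV _ (tree_le_refl V); apply: clones_inj.
Qed.

(** * The endomorphism *)

Definition forget_right_triple (t : triples) : Pbr :=
  if val (tagged t).1 is Node l _ then
    pbr (ntree_of l) (restrict (nleaves l) (tagged t).2)
  else 1.

(** Removes the dependence on [nleaves (val U)], which equals [m] only
    propositionally. *)
Lemma pbr_ntree_of m (U : ntree m) n (p : PB n) :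
  pbr (ntree_of (val U)) (restrict (nleaves (val U)) p) = pbr U (restrict m p).
Proof.
case: U => U e /=; have n_eq := eqP e; case: m / n_eq e => e.
by congr pbr; apply: val_inj.
Qed.

Lemma PB1_trivial (p : PB 1) : p = 1.
Proof.
apply: val_inj; rewrite -[val p]reprK; case: (repr _) => [|[[i lt_i] b] w] //.
Qed.

Lemma expand_forget_right t t' : expand_step t t' ->
  forget_right_triple t = forget_right_triple t'.
Proof.
case=> {t t'} n [[|l r] /= e] p k kn; rewrite /forget_right_triple /=.
  have /= n1 := eqP e; case: n / n1 e p kn => e p kn.
  by rewrite [restrict _ _]PB1_trivial pbr1.
case: ifP => kl; last by rewrite restrict_kappa_ge // leqNgt kl.
rewrite (@pbr_ntree_of _ (attach (ntree_of l) k)) restrict_kappa_lt //.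
by rewrite pbr_attach.
Qed.

Definition forget_right (x : Pbr) : Pbr := forget_right_triple (repr x).

Lemma forget_rightE n (T : ntree n) p :
  forget_right (pbr T p) = forget_right_triple (triple T p).
Proof.
have /pi_pbrP : \pi_Pbr (repr (pbr T p)) = \pi_Pbr (triple T p) by rewrite reprK.
rewrite /forget_right.
by elim=> [t t' /expand_forget_right||t t' _ ->|t t' u _ -> _ ->].
Qed.

Lemma forget_rightM : {morph forget_right : x y / x * y}.
Proof.
move=> x y; have [n [T [p [q [-> ->]]]]] := pbr_common x y.
rewrite pbrM !forget_rightE /forget_right_triple /=.
by case: (val T) => [|l r]; rewrite ?mul1g // restrictM pbrM.
Qed.

HB.instance Definition _ := isMultiplicative.Build _ _ forget_right forget_rightM.

(** The preimage adds a right leaf to the tree.  Here [kappa n p] clones beyond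
    the last strand, and so adds a trivial strand at the end. *)
Lemma forget_right_surj y : exists x, forget_right x = y.
Proof.
have [n [T [p ->]]] := pbr_rep y.
have e : nleaves (Node (val T) Leaf) == n.+1 by rewrite /= (eqP (valP T)) addn1.
exists (pbr (exist _ (Node (val T) Leaf) e : ntree n.+1) (kappa n p)).
rewrite forget_rightE /forget_right_triple /= pbr_ntree_of.
by rewrite restrict_kappa_ge // restrict_id.
Qed.

(** * The full twist *)

Definition exponent n (w : word n) : int := \sum_(l <- w) (if l.2 then -1 else 1)%R.

Lemma exponent_pi n (u v : word n) :
  \pi_(braid n) u = \pi_(braid n) v -> exponent u = exponent v.
Proof.
apply: braid_lift => p s {}u {}v uv; rewrite /exponent !big_cat /=.
congr (_ + (_ + _))%R; case: uv => [i []|i j _|i j _] //=.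
all: by rewrite !big_cons big_nil.
Qed.

Lemma full_twist_pure : pure 2 (sg 2 0 * sg 2 0).
Proof. by apply/pureP=> k _; rewrite strandM !strand_sg // swapK. Qed.

Definition full_twist : PB 2 := Sub (sg 2 0 * sg 2 0) full_twist_pure.

Lemma full_twist_neq1 : full_twist <> 1.
Proof.
move/(congr1 val); rewrite SubK val1 (sgE (ord0 : 'I_2.-1)) -pi_cat -pi_nil.
by move/exponent_pi; rewrite /exponent /= !big_cons big_nil.
Qed.

Definition caret : ntree 2 := ntree_of (Node Leaf Leaf).

Theorem proposition4p8 :
  exists f : {multiplicative Pbr -> Pbr},
    (forall y : Pbr, exists x : Pbr, f x = y) /\ ~ injective f.
Proof.
exists forget_right; split; first exact: forget_right_surj.
move/(_ (pbr caret full_twist) (pbr caret 1)) => inj.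
apply: full_twist_neq1; apply: (@pbr_inj _ caret); apply: inj.
rewrite /= !forget_rightE /forget_right_triple /=.
by congr pbr; rewrite [LHS]PB1_trivial [RHS]PB1_trivial.
Qed.
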